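(* Let $\alpha\ge1$ be an integer. (i) Given an $n$-qubit pure state $|\psi\rangle$ as a matrix product state (MPS) of bond dimension $\chi$ and a partition of the sites into $A,B,C$, the partial transpose moment $p_\alpha(\rho)$ of $\rho=\mathrm{tr}_C(|\psi\rangle\langle\psi|)$ can be computed with cost $O(n\alpha\chi^{2\alpha+1})$. (ii) Given an $n$-qubit density matrix $\rho$ as a matrix product operator (MPO) of bond dimension $\chi$ and a bipartition of the sites into $A,B$, the moment $p_\alpha(\rho)$ can be computed with cost $O(n\alpha\chi^{\alpha+1})$.
   Context: An MPS of bond dimension $\chi$ is $|\psi\rangle=\sum_{s_1,\dots,s_n\in\{0,1\}}A_1^{s_1}A_2^{s_2}\cdots A_n^{s_n}|s_1,\dots,s_n\rangle$ with $\chi\times\chi$ matrices $A_i^{s_i}$ (a $1\times\chi$ row vector at $i=1$, a $\chi\times1$ column vector at $i=n$). An MPO of bond dimension $\chi$ is $\rho=\sum_{s,s'}W_1^{s_1,s_1'}\cdots W_n^{s_n,s_n'}|s_1,\dots,s_n\rangle\langle s_1',\dots,s_n'|$ with $\chi\times\chi$ matrices $W_i^{s_i,s_i'}$ (boundary row/column vectors likewise). $p_\alpha(\rho)=\mathrm{tr}((\rho^\Gamma)^\alpha)$, where $\Gamma$ is the partial transpose on $B$: $(X_A\otimes Y_B)^\Gamma=X_A\otimes Y_B^T$. Cost means the number of elementary arithmetic operations on the tensor entries, as a function of $n$ and $\chi$ (local dimension $2$). *)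

(* Defs.v *)
From mathcomp Require Import all_boot all_order all_algebra.
From mathcomp Require Export reals complex.

Set Implicit Arguments.
Unset Strict Implicit.
Unset Printing Implicit Defensive.

Import Order.TTheory GRing.Theory Num.Theory.
Local Open Scope ring_scope.
Local Open Scope sesquilinear_scope.

(* Labels s of the computational basis vectors |s> of qubits indexed by I. *)
Definition conf (I : finType) := {ffun I -> bool}.

(* Vectors and operators on the 2^#|I|-dimensional space; the basis is
   enumerated by enum_rank / enum_val. *)
Definition ket (K : Type) (I : finType) := 'cV[K]_#|{: conf I}|.
Definition op (K : Type) (I : finType) := 'M[K]_#|{: conf I}|.

Definition ket_of (K : Type) (I : finType) (f : conf I -> K) : ket K I :=
  \col_i f (enum_val i).

Definition op_of (K : Type) (I : finType) (f : conf I -> conf I -> K) :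
  op K I := \matrix_(i, j) f (enum_val i) (enum_val j).

(* The matrix element <s|X|t>. *)
Definition elt (K : Type) (I : finType) (X : op K I) (s t : conf I) : K :=
  X (enum_rank s) (enum_rank t).

Definition normalized (K : numClosedFieldType) (I : finType) (psi : ket K I) :=
  psi ^t* *m psi = 1%:M.

Definition proj (K : numClosedFieldType) (I : finType) (psi : ket K I) :
  op K I := psi *m psi ^t*.

Definition density_matrix (K : numClosedFieldType) (I : finType)
    (rho : op K I) :=
  [/\ rho \is hermsymmx,
      forall v : ket K I, 0 <= (v ^t* *m rho *m v) 0 0
    & \tr rho = 1].

Definition restrict (I : finType) (P : pred I) (s : conf I) :
  conf {i | P i} := [ffun u => s (val u)].

(* The configuration of I equal to s off S and to c on S; the innermost
   default is never reached. *)
Definition glue (I : finType) (S : {set I})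
    (s : conf {i | i \notin S}) (c : conf {i | i \in S}) : conf I :=
  [ffun i => oapp s (oapp c false (insub i)) (insub i)].

(* tr_S, an operator on the qubits outside S. *)
Definition ptrace (K : numClosedFieldType) (I : finType) (S : {set I})
    (X : op K I) : op K {i | i \notin S} :=
  op_of (fun s t => \sum_c elt X (glue s c) (glue t c)).

Definition mix (I : finType) (S : {set I}) (s t : conf I) : conf I :=
  [ffun i => if i \in S then t i else s i].

(* Partial transpose on S: row and column labels are exchanged on S only.
   ptranspose_tensop and ptranspose_linear below characterize it. *)
Definition ptranspose (K : Type) (I : finType) (S : {set I}) (X : op K I) :
  op K I := op_of (fun s t => elt X (mix S s t) (mix S t s)).

Definition pt_moment (K : numClosedFieldType) (I : finType) (alpha : nat)
    (S : {set I}) (rho : op K I) : K :=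
  \tr ((ptranspose S rho) ^+ alpha).

(* X (x) Y with X acting off S and Y acting on S. *)
Definition tensop (K : numClosedFieldType) (I : finType) (S : {set I})
    (X : op K {i | i \notin S}) (Y : op K {i | i \in S}) : op K I :=
  op_of (fun s t =>
    elt X (restrict _ s) (restrict _ t) * elt Y (restrict _ s) (restrict _ t)).

Lemma elt_op_of (K : Type) (I : finType) (f : conf I -> conf I -> K) s t :
  elt (op_of f) s t = f s t.
Proof. by rewrite /elt mxE !enum_rankK. Qed.

Lemma ptranspose_tensop (K : numClosedFieldType) (I : finType) (S : {set I})
    (X : op K {i | i \notin S}) (Y : op K {i | i \in S}) :
  ptranspose S (tensop X Y) = tensop X (Y^T : op K _).
Proof.
have mixl (s t : conf I) : restrict (fun i => i \notin S) (mix S s t) =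
    restrict (fun i => i \notin S) s.
  by apply/ffunP => -[i iS]; rewrite !ffunE /= (negbTE iS).
have mixr (s t : conf I) : restrict (fun i => i \in S) (mix S s t) =
    restrict (fun i => i \in S) t.
  by apply/ffunP => -[i iS]; rewrite !ffunE /= iS.
apply/matrixP => i j; rewrite mxE elt_op_of [RHS]mxE !mixl !mixr.
by congr (_ * _); rewrite /elt [RHS]mxE.
Qed.

Lemma ptranspose_linear (K : numClosedFieldType) (I : finType) (S : {set I})
    (a : K) (X Y : op K I) :
  ptranspose S (a *: X + Y : op K I) = a *: ptranspose S X + ptranspose S Y.
Proof. by apply/matrixP => i j; rewrite !mxE /elt !mxE. Qed.

(* Dimension of the bond between sites k-1 and k (sites numbered from 0):
   chi inside the chain and 1 at both ends, so the first tensor is a row, the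
   last one a column, and for n = 1 the only tensor is 1 x 1. *)
Definition bond (n chi k : nat) : nat :=
  if (0 < k < n)%N then chi else 1%N.

Lemma bond_last n chi : bond n chi n = 1%N.
Proof. by rewrite /bond ltnn andbF. Qed.

(* P is the type of physical indices of one site. *)
Definition train (K P : Type) (n chi : nat) :=
  forall i : 'I_n, P -> 'M[K]_(bond n chi i, bond n chi i.+1).

Fixpoint train_prefix (K : numClosedFieldType) (P : Type) (n chi : nat)
    (T : train K P n chi) (x : 'I_n -> P) (k : nat) :
    (k <= n)%N -> 'M[K]_(1, bond n chi k) :=
  match k return (k <= n)%N -> 'M[K]_(1, bond n chi k) with
  | 0 => fun=> 1%:M
  | k'.+1 => fun lt_k'n =>
      train_prefix T x (ltnW lt_k'n) *m T (Ordinal lt_k'n) (x (Ordinal lt_k'n))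
  end.

(* The scalar T_1^{x_1} T_2^{x_2} ... T_n^{x_n}. *)
Definition train_prod (K : numClosedFieldType) (P : Type) (n chi : nat)
    (T : train K P n chi) (x : 'I_n -> P) : K :=
  castmx (erefl, bond_last n chi) (train_prefix T x (leqnn n)) 0 0.

Definition mps (K : Type) (n chi : nat) := train K bool n chi.
Definition mpo (K : Type) (n chi : nat) := train K (bool * bool)%type n chi.

Definition mps_ket (K : numClosedFieldType) (n chi : nat) (A : mps K n chi) :
  ket K 'I_n := ket_of (fun s => train_prod A s).

Definition mpo_op (K : numClosedFieldType) (n chi : nat) (W : mpo K n chi) :
  op K 'I_n := op_of (fun s s' => train_prod W (fun i => (s i, s' i))).

(* Names of the entries of a train: site, physical index, row, column. *)
Definition entry_name (P : Type) (n chi : nat) :=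
  {i : 'I_n & (P * ('I_(bond n chi i) * 'I_(bond n chi i.+1)))%type}.

Definition entry_val (K P : Type) (n chi : nat) (T : train K P n chi)
    (e : entry_name P n chi) : K :=
  T (tag e) (tagged e).1 (tagged e).2.1 (tagged e).2.2.

(* Straight-line programs over inputs named by V.  Every instruction is one
   elementary arithmetic operation and writes a fresh register; reading an
   input, a register or the constants 0 and 1 is free, and no other constants
   are available.  Complex conjugation is charged as an operation. *)
Inductive operand (V : Type) :=
  | Inp of V | Reg of nat | Zero | One.

Inductive instr (V : Type) :=
  | Add of operand V & operand V
  | Sub of operand V & operand V
  | Mul of operand V & operand V
  | Conj of operand V.

Record program (V : Type) := Program {
  code : seq (instr V);
  output : operand V }.

Definition cost (V : Type) (p : program V) : nat := size (code p).

(* Register number k holds the result of instruction number k (from 0); a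
   register that has not been written reads as 0. *)
Definition read (K : numClosedFieldType) (V : Type) (inp : V -> K)
    (regs : seq K) (o : operand V) : K :=
  match o with
  | Inp v => inp v
  | Reg k => nth 0 regs k
  | Zero => 0
  | One => 1
  end.

Definition step (K : numClosedFieldType) (V : Type) (inp : V -> K)
    (regs : seq K) (c : instr V) : seq K :=
  rcons regs
    match c with
    | Add x y => read inp regs x + read inp regs y
    | Sub x y => read inp regs x - read inp regs y
    | Mul x y => read inp regs x * read inp regs y
    | Conj x => (read inp regs x)^*
    end.

Definition run (K : numClosedFieldType) (V : Type) (inp : V -> K)
    (p : program V) : K :=
  read inp (foldl (step inp) [::] (code p)) (output p).

(* Main.v *)
Require Import Defs.
From mathcomp Require Import all_boot all_order all_algebra reals complex zify.

(* The moment tr X^alpha of an operator X whose matrix elements are products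
   along a chain of n tensors is a network on the alpha x n cylinder: the
   physical labels run around the rings, one ring per site, and the bond indices
   run along the chains, one chain per copy of X.  The partial transpose only
   reverses the roles of the two labels of a tensor.  Instead of multiplying n
   operators of dimension chi^alpha, one contracts the n alpha tensors one by
   one: in the middle of a ring the state consists of alpha bond indices, the
   label at which the ring was opened and the current label, hence of
   4 chi^alpha numbers, and absorbing one tensor takes a sum of 2 chi terms for
   each of them.  For the reduced state of an MPS there are 2 alpha chains, since
   every copy of rho consists of one copy of psi and one of its conjugate. *)

Set Implicit Arguments.
Unset Strict Implicit.
Unset Printing Implicit Defensive.

Import GRing.Theory Num.Theory.
Local Open Scope ring_scope.

(** * Kernel products along chains and rings *)

Section Chains.
Variables (K : comPzSemiRingType).

Definition dirac (D : eqType) (d : D) : D -> K := fun d' => (d' == d)%:R.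

(** [u] is a row vector and the [G i] are matrices indexed by [D], multiplied from left to right.
    Functions replace matrices so that [D] may be any product or function type. *)
Definition vchain (I : Type) (D : finType) (G : I -> D -> D -> K)
    (r : seq I) (u : D -> K) : D -> K :=
  foldl (fun v i d' => \sum_d v d * G i d d') u r.

Definition trchain (I : Type) (D : finType) (G : I -> D -> D -> K)
    (r : seq I) : K :=
  \sum_d vchain G r (dirac d) d.

Lemma vchain_rcons (I : Type) (D : finType) (G : I -> D -> D -> K) r i u d' :
  vchain G (rcons r i) u d' = \sum_d vchain G r u d * G i d d'.
Proof. by rewrite /vchain foldl_rcons. Qed.

Lemma eq_vchain (I : Type) (D : finType) (G G' : I -> D -> D -> K) r u u' :
    (forall i d d', G i d d' = G' i d d') -> u =1 u' ->
  vchain G r u =1 vchain G' r u'.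
Proof.
move=> eqG; elim: r u u' => //= i r IHr u u' equ; apply: IHr => d'.
by apply: eq_bigr => d _; rewrite eqG equ.
Qed.

Lemma eq_trchain (I : Type) (D : finType) (G G' : I -> D -> D -> K) r :
    (forall i d d', G i d d' = G' i d d') ->
  trchain G r = trchain G' r.
Proof. by move=> eqG; apply: eq_bigr => d _; apply: eq_vchain. Qed.

Lemma vchain_map (I J : Type) (D : finType) (f : J -> I)
    (G : I -> D -> D -> K) r u :
  vchain G (map f r) u =1 vchain (G \o f) r u.
Proof. by elim: r u => //= i r IHr u d; apply: IHr. Qed.

Lemma vchain0 (I : Type) (D : finType) (G : I -> D -> D -> K) r u :
  (forall d, u d = 0) -> forall d, vchain G r u d = 0.
Proof.
elim: r u => //= i r IHr u u0; apply: IHr => d'.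
by rewrite big1 // => d _; rewrite u0 mul0r.
Qed.

Lemma vchain_scale (I : Type) (D : finType) (k : I -> K)
    (G : I -> D -> D -> K) r u d :
  vchain (fun i d d' => k i * G i d d') r u d =
  (\prod_(i <- r) k i) * vchain G r u d.
Proof.
elim/last_ind: r d => [|r i IHr] d; first by rewrite big_nil mul1r.
rewrite !vchain_rcons big_rcons /= big_distrr; apply: eq_bigr => e _ /=.
by rewrite IHr mulrACA.
Qed.

Lemma vchain_pair (I : Type) (D1 D2 : finType) (G1 : I -> D1 -> D1 -> K)
    (G2 : I -> D2 -> D2 -> K) r u1 u2 d1 d2 :
  vchain (fun i d d' => G1 i d.1 d'.1 * G2 i d.2 d'.2) r
    (fun d => u1 d.1 * u2 d.2) (d1, d2) =
  vchain G1 r u1 d1 * vchain G2 r u2 d2.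
Proof.
elim/last_ind: r d1 d2 => [|r i IHr] d1 d2 //.
rewrite !vchain_rcons big_distrlr pair_big /=; apply: eq_bigr => -[e1 e2] _ /=.
by rewrite IHr mulrACA.
Qed.

Lemma vchain_bij (I : Type) (D D' : finType) (phi : D' -> D)
    (G : I -> D -> D -> K) r u d :
    bijective phi ->
  vchain (fun i d d' => G i (phi d) (phi d')) r (u \o phi) d =
  vchain G r u (phi d).
Proof.
move=> phi_bij; elim/last_ind: r d => [|r i IHr] d //.
rewrite !vchain_rcons [RHS](reindex phi); last exact: onW_bij.
by apply: eq_bigr => e _; rewrite IHr.
Qed.

(* A ring of kernels vanishing off the image of an injection phi lives on
   that image; for an empty ring the two sides are the cardinals of D, D'. *)
Lemma trchain_inj (I : Type) (D D' : finType) (phi : D' -> D)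
    (G : I -> D -> D -> K) r :
    injective phi ->
    (forall i d d', d \notin codom phi -> G i d d' = 0) ->
    (forall i d d', d' \notin codom phi -> G i d d' = 0) ->
    (0 < size r)%N ->
  trchain G r = trchain (fun i d d' => G i (phi d) (phi d')) r.
Proof.
move=> phi_inj G0l G0r r_gt0.
have sum_im (g : D -> K) : (forall d, d \notin codom phi -> g d = 0) ->
    \sum_d g d = \sum_d g (phi d).
  move=> g0; rewrite (bigID (mem (codom phi))) /= [X in _ + X]big1 // addr0.
  rewrite -[RHS](big_map phi xpredT g) -[in LHS]big_filter.
  rewrite [RHS](perm_big (filter (mem (codom phi)) (index_enum D))) //.
  apply: uniq_perm; rewrite ?filter_uniq ?index_enum_uniq //.
    by rewrite map_inj_uniq ?index_enum_uniq.
  move=> d; rewrite mem_filter mem_index_enum andbT /=.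
  apply/mapP/codomP => [[e _ ->]|[e ->]]; first by exists e.
  by exists e; rewrite ?mem_index_enum.
rewrite /trchain sum_im => [|d ndim].
  apply: eq_bigr => d _.
  (* A chain from the image back into it contributes only through paths inside it, since [G]
     vanishes on all other incoming indices. *)
  have vchainE (s : seq I) (e : D') : vchain G s (dirac (phi d)) (phi e) =
      vchain (fun i d d' => G i (phi d) (phi d')) s (dirac d) e.
    elim/last_ind: s e => [|s i IHs] e; first by rewrite /= /dirac inj_eq.
    rewrite !vchain_rcons sum_im => [|f nfim]; last by rewrite G0l ?mulr0.
    by apply: eq_bigr => f _; rewrite IHs.
  exact: vchainE.
(* A start outside the image is killed by the first kernel, which exists because [r] is nonempty. *)
case: r r_gt0 => // i r _ /=; apply: vchain0 => e.
rewrite big1 // => f _; rewrite /dirac; case: eqP => [->|_]; last by rewrite mul0r.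
by rewrite G0l ?mulr0.
Qed.

(** Consecutive kernels merge into their matrix product. This joins the two tensors of one copy of a
    reduced pure state into a single kernel. *)
Lemma vchain_flatten2 (I J : Type) (D : finType) (f g : J -> I)
    (G : I -> D -> D -> K) r u :
  vchain G (flatten [seq [:: f j; g j] | j <- r]) u =1
  vchain (fun j d d' => \sum_e G (f j) d e * G (g j) e d') r u.
Proof.
elim: r u => //= j r IHr u d; rewrite IHr; apply: eq_vchain => // d'.
under eq_bigr do rewrite big_distrl.
rewrite exchange_big; apply: eq_bigr => e _ /=; rewrite big_distrr /=.
by apply: eq_bigr => e' _; rewrite mulrA.
Qed.

(** Sum over paths: [b] gives the index at the n + 1 positions before, between and after the
    kernels. In this form, exchanging contraction orders is a reindexing of finite sums. *)
Lemma vchain_path n (D : finType) (G : 'I_n -> D -> D -> K) u d' :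
  vchain G (enum 'I_n) u d' =
  \sum_(b : {ffun 'I_n.+1 -> D} | b ord_max == d')
    u (b ord0) *
      \prod_(i < n) G i (b (widen_ord (leqnSn n) i)) (b (lift ord0 i)).
Proof.
elim: n => [|n IHn] in G u *.
  rewrite enum_ord0 /= (big_pred1 [ffun=> d']) => [|b /=].
    by rewrite ffunE big_ord0 mulr1.
  apply/eqP/eqP => [<-|->]; last by rewrite ffunE.
  by apply/ffunP => i; rewrite ffunE (ord1 i) (ord1 ord_max).
(* The induction peels off the first kernel, so a path is split into its initial index and the
   remaining path. *)
pose cons (p : D * {ffun 'I_n.+1 -> D}) : {ffun 'I_n.+2 -> D} :=
  [ffun i => oapp p.2 p.1 (unlift ord0 i)].
pose uncons (b : {ffun 'I_n.+2 -> D}) := (b ord0, [ffun i => b (lift ord0 i)]).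
have consK : cancel cons uncons.
  move=> [d b]; congr pair; first by rewrite ffunE unlift_none.
  by apply/ffunP => i; rewrite !ffunE liftK.
have unconsK : cancel uncons cons.
  move=> b; apply/ffunP => i; rewrite ffunE.
  by case: unliftP => [j ->|->] //=; rewrite ffunE.
rewrite enum_ordSl /= [LHS]vchain_map IHn.
rewrite [RHS](reindex cons); last by apply: onW_bij; exists uncons.
under [LHS]eq_bigr do rewrite mulr_suml.
rewrite exchange_big /= pair_big_dep /=.
apply: eq_big => [[d b]|[d b] _] /=.
  by rewrite ffunE (_ : ord_max = lift ord0 ord_max) ?liftK //; apply: val_inj.
rewrite -mulrA; congr (_ * _); first by rewrite ffunE unlift_none.
rewrite big_ord_recl; congr (_ * _).
  rewrite !ffunE liftK (_ : widen_ord _ _ = ord0) ?unlift_none //.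
  exact: val_inj.
apply: eq_bigr => i _ /=; rewrite !ffunE liftK.
rewrite (_ : widen_ord _ _ = lift ord0 (widen_ord (leqnSn n) i)) ?liftK //.
exact: val_inj.
Qed.

Lemma vchain_dirac_path n (D : finType) (G : 'I_n -> D -> D -> K) d d' :
  vchain G (enum 'I_n) (dirac d) d' =
  \sum_(b : {ffun 'I_n.+1 -> D} | (b ord0 == d) && (b ord_max == d'))
    \prod_(i < n) G i (b (widen_ord (leqnSn n) i)) (b (lift ord0 i)).
Proof.
rewrite vchain_path big_mkcond [RHS]big_mkcond; apply: eq_bigr => b _ /=.
by rewrite /dirac; case: (b ord0 == d); rewrite ?mul1r //= mul0r if_same.
Qed.

Lemma trchain_path n (D : finType) (G : 'I_n -> D -> D -> K) :
  trchain G (enum 'I_n) =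
  \sum_(b : {ffun 'I_n.+1 -> D} | b ord0 == b ord_max)
    \prod_(i < n) G i (b (widen_ord (leqnSn n) i)) (b (lift ord0 i)).
Proof.
rewrite /trchain; under eq_bigr do rewrite vchain_dirac_path.
rewrite (exchange_big_dep (fun b : {ffun 'I_n.+1 -> D} => b ord0 == b ord_max))
  /= => [|d b _ /andP[/eqP-> /eqP->] //].
apply: eq_bigr => b /eqP b_eq; rewrite (big_pred1 (b ord0)) // => d.
by rewrite /= -b_eq andbb eq_sym.
Qed.

(** Distributivity: the label [z i] occurs only in kernel [i], so it can be summed there. *)
Lemma sum_vchain n (Q D : finType) (G : 'I_n -> Q -> D -> D -> K) d d' :
  \sum_(z : {ffun 'I_n -> Q})
    vchain (fun i => G i (z i)) (enum 'I_n) (dirac d) d' =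
  vchain (fun i e e' => \sum_q G i q e e') (enum 'I_n) (dirac d) d'.
Proof.
under eq_bigr do rewrite vchain_dirac_path.
rewrite vchain_dirac_path exchange_big; apply: eq_bigr => b _ /=.
by rewrite bigA_distr_bigA.
Qed.

Definition ftranspose (X Y : finType) (Z : Type)
    (h : {ffun X -> {ffun Y -> Z}}) : {ffun Y -> {ffun X -> Z}} :=
  [ffun y => [ffun x => h x y]].

Lemma ftransposeK (X Y : finType) (Z : Type) :
  cancel (@ftranspose X Y Z) (@ftranspose Y X Z).
Proof. by move=> h; apply/ffunP => x; apply/ffunP => y; rewrite !ffunE. Qed.

Lemma ftranspose_bij (X Y : finType) (Z : Type) :
  bijective (@ftranspose X Y Z).
Proof. exists (@ftranspose Y X Z); exact: ftransposeK. Qed.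

(* The network is a cylinder of m rings and n chains; either direction may be
   contracted first. *)
Lemma trchain_vchain_exchange m n (Q E : finType)
    (f : 'I_n -> Q -> Q -> E -> E -> K) (e : E) :
  trchain (fun (_ : 'I_m) (s t : {ffun 'I_n -> Q}) =>
      vchain (fun i => f i (s i) (t i)) (enum 'I_n) (dirac e) e) (enum 'I_m) =
  vchain (fun i (a c : {ffun 'I_m -> E}) =>
      trchain (fun k l l' => f i l l' (a k) (c k)) (enum 'I_m))
    (enum 'I_n) (dirac [ffun=> e]) [ffun=> e].
Proof.
rewrite trchain_path vchain_dirac_path.
under eq_bigr => S _.
  under eq_bigr do rewrite vchain_dirac_path.
  rewrite bigA_distr_big; over.
under [RHS]eq_bigr => c _.
  under eq_bigr do rewrite trchain_path.
  rewrite bigA_distr_big; over.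
rewrite exchange_big /=.
(* On the left the bond indices form one path per copy, on the right one configuration per cut of
   the chain. Transposition matches them, together with the conditions at both ends. *)
rewrite [LHS](reindex (@ftranspose 'I_n.+1 'I_m E)); last first.
  exact/onW_bij/ftranspose_bij.
apply: eq_big => [c|c _].
  apply/familyP/andP => [fam|[/eqP c0 /eqP cn] k].
    split; apply/eqP/ffunP => k; have /andP[] := fam k; rewrite !ffunE.
      by move=> /eqP.
    by move=> _ /eqP.
  by rewrite unfold_in /= !ffunE c0 cn !ffunE eqxx.
(* Likewise for the physical labels: a closed path of configurations is a family of closed paths,
   one per site. *)
rewrite [LHS](reindex (@ftranspose 'I_n 'I_m.+1 Q)); last first.
  exact/onW_bij/ftranspose_bij.
apply: eq_big => [l|l _].
  apply/eqP/familyP => [eql i|fam].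
    by rewrite unfold_in /=; have /ffunP/(_ i) := eql; rewrite !ffunE => ->.
  by apply/ffunP => i; have := fam i; rewrite unfold_in !ffunE => /eqP.
rewrite exchange_big /=; apply: eq_bigr => i _; apply: eq_bigr => k _.
by rewrite !ffunE.
Qed.

End Chains.

Lemma rmorph_vchain (K K' : comPzSemiRingType) (h : {rmorphism K -> K'})
    (I : Type) (D : finType) (G : I -> D -> D -> K) r u d :
  vchain (fun i d d' => h (G i d d')) r (h \o u) d = h (vchain G r u d).
Proof.
elim/last_ind: r d => [|r i IHr] d //.
rewrite !vchain_rcons rmorph_sum; apply: eq_bigr => e _.
by rewrite IHr rmorphM.
Qed.

(** Only the length of [r] matters; taking [enum 'I_m] gives the ring of [m] copies to which the
    exchange of contraction orders applies. *)
Lemma mxtrace_exp_trchain (K : numClosedFieldType) (I : finType) (X : op K I)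
    (J : Type) (r : seq J) :
  \tr (X ^+ size r) = trchain (fun=> elt X) r.
Proof.
have powE (s : seq J) (x y : conf I) :
    (X ^+ size s) (enum_rank x) (enum_rank y) =
    vchain (fun=> elt X) s (dirac K x) y.
  elim/last_ind: s y => [|s j IHs] y.
    by rewrite expr0 mxE /dirac /= (inj_eq enum_rank_inj) eq_sym.
  rewrite size_rcons exprSr vchain_rcons mxE (reindex enum_rank) /=; last first.
    exact/onW_bij/enum_rank_bij.
  by apply: eq_bigr => z _; rewrite IHs.
rewrite /mxtrace (reindex enum_rank) /=; last exact/onW_bij/enum_rank_bij.
by apply: eq_bigr => x _; rewrite powE.
Qed.

Lemma eq_in_vchain (K : comPzSemiRingType) (I : eqType) (D : finType)
    (G G' : I -> D -> D -> K) r u :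
    (forall i d d', i \in r -> G i d d' = G' i d d') ->
  vchain G r u =1 vchain G' r u.
Proof.
elim/last_ind: r => //= r i IHr eqG d'; rewrite !vchain_rcons.
apply: eq_bigr => d _; rewrite eqG ?mem_rcons ?mem_head // IHr // => j e e' jr.
by apply: eqG; rewrite mem_rcons inE jr orbT.
Qed.

(** * Straight-line programs for sparse linear maps *)

Section StraightLine.
Variable V : Type.

(* A coefficient is an input or a constant 0 or 1, together with a flag asking
   for its complex conjugate. *)
Definition source := (V + bool)%type.
Definition coef := (bool * source)%type.

Definition source_operand (x : source) : operand V :=
  match x with inl v => Inp v | inr b => if b then One V else Zero V end.

(** A sparse matrix stored by output index: each [D'] lists the inputs it reads, with their
    coefficients. *)
Definition layer (D D' : Type) := D' -> seq (D * coef).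

(** The conjugate is emitted even when it is not read, so that every term costs exactly three
    instructions. *)
Definition emit_term (t : operand V * coef)
    (ca : seq (instr V) * operand V) : seq (instr V) * operand V :=
  let m := size ca.1 in
  let x := source_operand t.2.2 in
  (ca.1 ++ [:: Conj x; Mul t.1 (if t.2.1 then Reg V m else x);
               Add (Reg V m.+1) ca.2],
   Reg V m.+2).

Definition emit_sum (ts : seq (operand V * coef)) (c : seq (instr V)) :=
  foldr emit_term (c, Zero V) ts.

Definition emit_family (D : eqType) (ts : D -> seq (operand V * coef))
    (ds : seq D) (c : seq (instr V)) : seq (instr V) * (D -> operand V) :=
  foldr (fun d cg => let ca := emit_sum (ts d) cg.1 in
      (ca.1, fun d' => if d' == d then ca.2 else cg.2 d'))
    (c, fun=> Zero V) ds.

Definition emit_layer (D D' : finType) (l : layer D D')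
    (cg : seq (instr V) * (D -> operand V)) :=
  emit_family (fun d => [seq (cg.2 t.1, t.2) | t <- l d]) (enum D') cg.1.

Definition emit_layers (D : finType) (J : Type) (l : J -> layer D D)
    (r : seq J) (cg : seq (instr V) * (D -> operand V)) :=
  foldl (fun cg j => emit_layer (l j) cg) cg r.

Lemma size_emit_sum ts c : size (emit_sum ts c).1 = (size c + 3 * size ts)%N.
Proof.
elim: ts => [|t ts IH] /=; first by rewrite addn0.
rewrite size_cat -/(emit_sum ts c) IH /=; lia.
Qed.

Lemma size_emit_layer (D D' : finType) (l : layer D D') cg m :
    (forall d, size (l d) <= m)%N ->
  (size (emit_layer l cg).1 <= size cg.1 + #|D'| * (3 * m))%N.
Proof.
move=> lm; rewrite /emit_layer cardE; elim: (enum D') => [|d ds IH] /=.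
  by rewrite leq_addr.
rewrite size_emit_sum size_map (mulSn _ (3 * m)) [leqRHS]addnCA addnC.
apply: leq_add; last exact: IH.
by rewrite leq_mul2l lm orbT.
Qed.

Lemma size_emit_layers (D : finType) (J : Type) (l : J -> layer D D) r cg m :
    (forall j d, size (l j d) <= m)%N ->
  (size (emit_layers l r cg).1 <= size cg.1 + size r * (#|D| * (3 * m)))%N.
Proof.
move=> lm; elim: r cg => [|j r IHr] cg /=; first by rewrite leq_addr.
apply: leq_trans (IHr _) _; rewrite (mulSn (size r)) addnA leq_add2r.
exact: size_emit_layer.
Qed.

(** * Correctness of the emitted code *)

Variables (K : numClosedFieldType) (inp : V -> K).

Definition source_val (x : source) : K := read inp [::] (source_operand x).

Definition coef_val (x : coef) : K :=
  if x.1 then (source_val x.2)^* else source_val x.2.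

Definition registers (c : seq (instr V)) : seq K := foldl (step inp) [::] c.

(** An unwritten register reads as 0 but may change when the code is extended; the values of live
    operands persist. *)
Definition live (m : nat) (o : operand V) : bool :=
  if o is Reg k then (k < m)%N else true.

Lemma size_registers c : size (registers c) = size c.
Proof.
elim/last_ind: c => //= c x IHc.
by rewrite /registers foldl_rcons /= !size_rcons IHc.
Qed.

Lemma read_registers_cat c c' o :
  live (size c) o -> read inp (registers (c ++ c')) o = read inp (registers c) o.
Proof.
case: o => //= k k_lt; elim/last_ind: c' => [|c' x IHc']; first by rewrite cats0.
rewrite -rcons_cat /registers foldl_rcons /= nth_rcons -/(registers _).
by rewrite size_registers size_cat ltn_addr.
Qed.

Lemma live_leq m m' o : (m <= m')%N -> live m o -> live m' o.
Proof. by case: o => //= k le_m lt_k; apply: leq_trans lt_k le_m. Qed.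

Definition computes (c : seq (instr V)) (o : operand V) (x : K) :=
  live (size c) o /\ read inp (registers c) o = x.

Lemma computes_cat c c' o x : computes c o x -> computes (c ++ c') o x.
Proof.
move=> [lo <-]; split; last exact: read_registers_cat.
by apply: live_leq lo; rewrite size_cat leq_addr.
Qed.

Lemma computes_source c x : computes c (source_operand x) (source_val x).
Proof. by case: x => [v|[]]. Qed.

Lemma computes_emit_term c t a x y :
    computes c t.1 x -> computes c a y ->
  exists c', (emit_term t (c, a)).1 = c ++ c' /\
    computes (c ++ c') (emit_term t (c, a)).2 (x * coef_val t.2 + y).
Proof.
case: t => o [b s] /= [lo ro] [la ra]; eexists; split; first by [].
split; first by rewrite /= size_cat addn3.
rewrite /= /registers foldl_cat -/(registers c) /=.
have sz := size_registers c.
rewrite /step /= nth_rcons !size_rcons sz ltnn eqxx.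
rewrite (nth_rcons _ _ (_ * _)) size_rcons sz ltnn eqxx.
(* The registers written by the new instructions do not disturb the operands that were live
   before. *)
have readE z p q : live (size c) p ->
    read inp (rcons (registers c) z) p = read inp (registers c) p /\
    read inp (rcons (rcons (registers c) z) q) p = read inp (registers c) p.
  by case: p => //= k lk; rewrite !nth_rcons !size_rcons sz ltnS lk ltnW.
have [ls sv] := computes_source c s.
rewrite (readE _ _ _ la).2 (readE _ _ 0 lo).1 ra ro; congr (_ * _ + _).
rewrite /coef_val /=.
case: b => /=; last by rewrite (readE _ _ 0 ls).1.
by rewrite nth_rcons sz ltnn eqxx sv.
Qed.

Definition realizes (D : Type) (c : seq (instr V)) (g : D -> operand V)
    (h : D -> K) :=
  forall d, computes c (g d) (h d).

Lemma realizes_cat D c c' (g : D -> operand V) h :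
  realizes c g h -> realizes (c ++ c') g h.
Proof. by move=> gP d; apply/computes_cat/gP. Qed.

Lemma computes_emit_sum D (l : seq (D * coef)) g h c :
    realizes c g h ->
  exists c', (emit_sum [seq (g t.1, t.2) | t <- l] c).1 = c ++ c' /\
    computes (c ++ c') (emit_sum [seq (g t.1, t.2) | t <- l] c).2
      (\sum_(t <- l) h t.1 * coef_val t.2).
Proof.
move=> gP; elim: l => [|t l [c1 []]] /=.
  by exists [::]; rewrite cats0 big_nil.
case: (emit_sum _ c) => _ a /= -> ca.
have ct : computes (c ++ c1) (g t.1, t.2).1 (h t.1) by apply/computes_cat/gP.
have [c2 [eqc2 cb]] := computes_emit_term ct ca.
by exists (c1 ++ c2); rewrite big_cons catA.
Qed.

Definition layer_val (D D' : Type) (l : layer D D') (h : D -> K) : D' -> K :=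
  fun d => \sum_(t <- l d) h t.1 * coef_val t.2.

Lemma realizes_emit_layer (D D' : finType) (l : layer D D') cg h :
    realizes cg.1 cg.2 h ->
  realizes (emit_layer l cg).1 (emit_layer l cg).2 (layer_val l h).
Proof.
case: cg => c g /= gP d; have := mem_enum D' d; rewrite /emit_layer /= inE.
(* The induction over the output indices also records that the code only grows, which keeps the
   operands of the previous layer valid. *)
suff [c' [-> P]] : exists c',
    (emit_family (fun d => [seq (g t.1, t.2) | t <- l d]) (enum D') c).1 =
      c ++ c' /\
    forall d, d \in enum D' -> computes (c ++ c')
      ((emit_family (fun d => [seq (g t.1, t.2) | t <- l d]) (enum D') c).2 d)
      (layer_val l h d).
  exact: P.
elim: (enum D') {d} => [|d ds [c1 []]] /=.
  by exists [::]; rewrite cats0.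
case: (emit_family _ ds c) => _ g1 /= -> g1P.
have [c2 [-> cd]] := computes_emit_sum (l d) (realizes_cat c1 gP).
exists (c1 ++ c2); rewrite catA; split=> // d'; rewrite inE.
case: eqP => [->|_] //= /g1P; exact: computes_cat.
Qed.

Lemma realizes_emit_layers (D : finType) (J : Type) (l : J -> layer D D) r cg h :
    realizes cg.1 cg.2 h ->
  realizes (emit_layers l r cg).1 (emit_layers l r cg).2
    (foldl (fun h j => layer_val (l j) h) h r).
Proof.
elim: r cg h => //= j r IHr cg h cgP; apply/IHr/realizes_emit_layer/cgP.
Qed.

End StraightLine.

(** * Contraction of a cylindrical network *)

Section Network.
(** [S] indexes the chains and [E] the bonds. [F i x s s' a b] is the tensor of chain [x] at site
    [i] with incoming label [s], outgoing label [s'], left bond [a] and right bond [b]; [w i] is the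
    order of the chains around the ring. *)
Variables (V : Type) (n : nat) (S E : finType) (e0 : E).
Variables (F : 'I_n -> S -> bool -> bool -> E -> E -> coef V).
Variables (w : 'I_n -> seq S).

Definition fupd (c : {ffun S -> E}) (x : S) (y : E) : {ffun S -> E} :=
  [ffun z => if z == x then y else c z].

(* Within a site, (s0, s, c) records the label s0 at which the ring was opened,
   the label s reached so far, and the bond indices: new ones on the slots
   already contracted, old ones elsewhere. *)
Definition state := (bool * bool * {ffun S -> E})%type.

(** Each new state [d] gathers its contributions: [d.2 x] is the right bond, while the previous
    label [s] and the left bond [y] are summed. *)
Definition slot_layer (i : 'I_n) (x : S) : layer V state state := fun d =>
  [seq ((d.1.1, s, fupd d.2 x y), F i x s d.1.2 y (d.2 x))
  | s <- [:: false; true], y <- enum E].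

(* Closes the ring of one site and opens the ring of the next one. *)
Definition trace_layer : layer V state state := fun d =>
  if d.1.1 == d.1.2 then
    [seq ((s, s, d.2), (false, inr true)) | s <- [:: false; true]]
  else [::].

Definition network_layer (j : 'I_n * option S) : layer V state state :=
  if j.2 is Some x then slot_layer j.1 x else trace_layer.

Definition network_schedule : seq ('I_n * option S) :=
  flatten [seq rcons [seq (i, Some x) | x <- w i] (i, None) | i <- enum 'I_n].

Definition network_start : seq (instr V) * (state -> operand V) :=
  ([::], fun d => if (d.1.1 == d.1.2) && (d.2 == [ffun=> e0])
                  then One V else Zero V).

Definition network_program : program V :=
  let cg := emit_layers network_layer network_schedule network_start in
  (* After the last ring is closed both states with equal labels hold the result, so [false] is an
     arbitrary choice. *)
  Program cg.1 (cg.2 (false, false, [ffun=> e0])).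

(** Each site takes [m] slot layers and one closing layer. A layer has 4 |E|^|S| states, each with
    at most 2 |E| terms of three instructions, whence the factor 24. *)
Lemma cost_network m :
    (forall i, size (w i) = m) ->
  (cost network_program <= 24 * (n * m.+1 * #|E| ^ #|S|.+1))%N.
Proof.
move=> sw; have E_gt0 : (0 < #|E|)%N by apply/card_gt0P; exists e0.
have size_layer j d : (size (network_layer j d) <= 2 * #|E|)%N.
  case: j => i [x|] /=; first by rewrite size_allpairs -cardE.
  rewrite /network_layer /trace_layer /=; case: (d.1.1 == d.1.2) => //=.
  exact: (leq_mul (leqnn 2) E_gt0).
rewrite /cost /=; apply: leq_trans (size_emit_layers _ _ size_layer) _ => /=.
have -> : size network_schedule = (n * m.+1)%N.
  rewrite /network_schedule size_flatten /shape -map_comp.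
  rewrite (eq_map (g := fun=> m.+1)) => [|i /=]; last first.
    by rewrite size_rcons size_map sw.
  by rewrite sumnE big_map big_enum sum_nat_const card_ord.
rewrite !card_prod card_bool card_ffun expnS.
by move: (#|E| ^ _)%N (n * _)%N => p q; rewrite leq_eqVlt; apply/orP; left; apply/eqP; nia.
Qed.

Variables (K : numClosedFieldType) (inp : V -> K).

Local Notation val := (coef_val inp).
Local Notation layer_fold i := (foldl (fun h x => layer_val inp (slot_layer i x) h)).

Lemma slot_layer_val i x h s0 s c :
  layer_val inp (slot_layer i x) h (s0, s, c) =
  \sum_s1 \sum_y h (s0, s1, fupd c x y) * val (F i x s1 s y (c x)).
Proof.
rewrite /layer_val /slot_layer big_allpairs_dep /= !big_cons big_nil.
by rewrite big_bool /= addr0 addrC !big_map -!big_enum.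
Qed.

Lemma trace_layer_val h s0 s c :
  layer_val inp trace_layer h (s0, s, c) =
  (s0 == s)%:R * \sum_s1 h (s1, s1, c).
Proof.
rewrite /layer_val /trace_layer /=; case: eqP => _; last by rewrite big_nil mul0r.
rewrite !big_cons big_nil big_bool /= addr0 addrC mul1r.
by rewrite !mulr1.
Qed.

(** [a] collects the bonds on entering the site. It agrees with [c] on the slots outside [r], whose
    bonds are not yet replaced; [uniq r] ensures that each bond is replaced only once. *)
Lemma slot_layers_val i (v : {ffun S -> E} -> K) (h : state -> K) r s0 s c :
    uniq r ->
    (forall s0 s c, h (s0, s, c) = (s0 == s)%:R * v c) ->
  layer_fold i h r (s0, s, c) =
  \sum_(a : {ffun S -> E} | [forall x, (x \in r) || (a x == c x)])
    v a * vchain (fun x t t' => val (F i x t t' (a x) (c x))) r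
            (dirac K s0) s.
Proof.
move=> + hE; elim/last_ind: r s c => [|r x IHr] s c.
  move=> _ /=; rewrite hE (big_pred1 c) => [|a /=]; last first.
    by apply/forallP/eqP => [ac|-> x //]; apply/ffunP => x; apply/eqP/ac.
  by rewrite mulrC /dirac eq_sym.
rewrite rcons_uniq => /andP[xr r_uniq].
rewrite foldl_rcons slot_layer_val.
under [RHS]eq_bigr do rewrite vchain_rcons big_distrr /=.
rewrite [RHS]exchange_big; apply: eq_bigr => s1 _ /=.
under eq_bigr do rewrite IHr // mulr_suml.
rewrite (exchange_big_dep (fun a : {ffun S -> E} =>
    [forall z, (z \in rcons r x) || (a z == c z)])) /= => [|y a _]; last first.
  move=> /forallP agr; apply/forallP => z; rewrite mem_rcons inE.
  by have := agr z; rewrite ffunE; case: (z == x).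
(* The summed left bond [y] at slot [x] is forced to equal [a x]. *)
apply: eq_bigr => a /forallP agr; rewrite (big_pred1 (a x)) => [|y /=].
  rewrite -mulrA; congr (_ * (_ * _)); apply: eq_in_vchain => z d d' zr.
  by rewrite ffunE; case: eqP zr xr => // -> ->.
apply/forallP/eqP => [/(_ x)|-> z]; rewrite ffunE ?eqxx ?(negbTE xr) /=.
  by move/eqP.
case: (z =P x) => [->|/eqP zx]; first by rewrite eqxx orbT.
by have := agr z; rewrite mem_rcons inE (negbTE zx).
Qed.

Lemma run_network :
    (forall i, uniq (w i)) -> (forall i x, x \in w i) ->
  run inp network_program =
  vchain (fun i (a c : {ffun S -> E}) =>
      trchain (fun x s s' => val (F i x s s' (a x) (c x))) (w i))
    (enum 'I_n) (dirac K [ffun=> e0]) [ffun=> e0].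
Proof.
move=> w_uniq w_full; pose h0 (d : state) : K :=
  (d.1.1 == d.1.2)%:R * dirac K [ffun=> e0] d.2.
have start : realizes inp network_start.1 network_start.2 h0.
  move=> [[s0 s] c]; split; rewrite /= /h0 /dirac /=; first by case: ifP.
  by do 2![case: (_ == _)]; rewrite /= ?mulr1 ?mulr0.
have [_ ] := realizes_emit_layers network_layer network_schedule start
  (false, false, [ffun=> e0]).
rewrite /run /network_program /= => ->.
(* The invariant between sites: the state is diagonal in its two labels, with the same vector for
   both label values. *)
suff fold_val (r : seq 'I_n) v (h : state -> K) s0 s c :
    (forall s0 s c, h (s0, s, c) = (s0 == s)%:R * v c) ->
    foldl (fun h j => layer_val inp (network_layer j) h) h
      (flatten [seq rcons [seq (i, Some x) | x <- w i] (i, None) | i <- r])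
      (s0, s, c) =
    (s0 == s)%:R * vchain (fun i (a c : {ffun S -> E}) =>
      trchain (fun x s s' => val (F i x s s' (a x) (c x))) (w i)) r v c.
  by rewrite (fold_val _ (dirac K [ffun=> e0])) // mul1r.
move=> hE; elim: r v h hE => [|i r IHr] v h hE //=.
rewrite foldl_cat; apply: IHr => {}s0 {}s {}c.
have foldE : foldl (fun h j => layer_val inp (network_layer j) h) h
    [seq (i, Some x) | x <- w i] = layer_fold i h (w i).
  by elim: (w i) (h) => //=.
rewrite foldl_rcons foldE trace_layer_val; congr (_ * _).
transitivity (\sum_s1 \sum_(a : {ffun S -> E} | [forall x, (x \in w i) || (a x == c x)])
    v a * vchain (fun x t t' => val (F i x t t' (a x) (c x))) (w i) (dirac K s1) s1).
  by apply: eq_bigr => s1 _; apply: slot_layers_val.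
rewrite (exchange_big_dep xpredT) //=; apply: eq_bigr => a _.
rewrite /trchain big_distrr; apply: eq_bigl => s1.
(* All slots have been visited, so there is no constraint left on [a]. *)
by apply/forallP => x; rewrite w_full.
Qed.

End Network.

(** * Matrix product operators *)

(* Entries outside the actual bond dimensions (at the two ends of the chain)
   are read as 0, so that all bonds can be given the index type
   'I_chi.-1.+1. *)
Definition entry_source (P : Type) (n chi : nat) (i : 'I_n) (p : P)
    (a b : nat) : source (entry_name P n chi) :=
  match insub a : option 'I_(bond n chi i),
        insub b : option 'I_(bond n chi i.+1) with
  | Some a', Some b' => inl (Tagged _ (p, (a', b')))
  | _, _ => inr false
  end.

Lemma sum_insub_ord (K : nmodType) m m' (h : 'I_m -> K) :
  (m <= m')%N -> \sum_(a < m') oapp h 0 (insub (a : nat)) = \sum_a h a.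
Proof.
move=> le_m; transitivity (\sum_(a < m) oapp h 0 (insub (a : nat))); last first.
  by apply: eq_bigr => a _; rewrite valK.
rewrite (big_ord_widen _ (fun a : nat => oapp h 0 (insub a)) le_m).
rewrite [RHS]big_mkcond; apply: eq_bigr => a _.
by case: ltnP => // le_ma; rewrite insubF // ltnNge le_ma.
Qed.

(** Zero padding does not change the products. The two end bonds have dimension one, so they become
    index [ord0] of the uniform bond type. *)
Lemma train_prod_vchain (K : numClosedFieldType) (P : Type) n chi
    (T : train K P n chi) (x : 'I_n -> P) :
    (0 < chi)%N ->
  train_prod T x =
  vchain (fun i (a b : 'I_chi.-1.+1) =>
      source_val (entry_val T) (entry_source chi i (x i) a b))
    (enum 'I_n) (dirac K ord0) ord0.
Proof.
move=> chi_gt0; set G := fun i => _.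
have prefixE k (le_kn : (k <= n)%N) (b : 'I_chi.-1.+1) :
    vchain G (take k (enum 'I_n)) (dirac K ord0) b =
    oapp (train_prefix T x le_kn 0) 0 (insub (b : nat)).
  elim: k => [|k IHk] in le_kn b *.
    rewrite take0 /= /dirac; case: insubP => [b' _ b'E|] /=.
      rewrite mxE; move: b' b'E; rewrite /bond /= => b'; rewrite (ord1 b') => b0.
      by rewrite (_ : b = ord0) ?eqxx //; apply: val_inj.
    by rewrite -val_eqE /bond /=; case: (val b).
  rewrite (take_nth (Ordinal le_kn)) ?size_enum_ord //.
  rewrite (_ : nth _ _ _ = Ordinal le_kn); last first.
    exact: nth_ord_enum (Ordinal le_kn) (Ordinal le_kn).
  rewrite vchain_rcons; under eq_bigr do rewrite (IHk (ltnW le_kn)).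
  rewrite /G /entry_source /source_val /=.
  case: (insub (b : nat) : option 'I_(bond n chi k.+1)) => [b'|] /=; last first.
    by rewrite big1 // => a _; case: insub => *; rewrite mulr0.
  rewrite mxE -[RHS](@sum_insub_ord _ _ chi.-1.+1); last first.
    by rewrite prednK // /bond; case: ifP.
  apply: eq_bigr => a _; case: insubP => [a' _ _|_] //=.
  by rewrite mul0r.
have := prefixE n (leqnn n) ord0.
rewrite take_oversize ?size_enum_ord // => ->; rewrite /train_prod castmxE /=.
case: insubP => [b' _ b'0|/negP[]]; last by rewrite bond_last.
by congr (train_prefix _ _ _ _ _); apply: val_inj; rewrite ?b'0.
Qed.

Definition mpo_coef m n chi (B : {set 'I_n}) (i : 'I_n) (k : 'I_m)
    (s s' : bool) (a b : 'I_chi.-1.+1) : coef (entry_name (bool * bool)%type n chi) :=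
  (false, entry_source chi i (if i \in B then (s', s) else (s, s')) a b).

Definition mpo_program (m n chi : nat) (B : {set 'I_n}) :
    program (entry_name (bool * bool)%type n chi) :=
  network_program ord0 (mpo_coef (chi:=chi) B) (fun=> enum 'I_m).

(** The constant is 2 times 24, from [m.+1 <= 2 * m]. *)
Lemma cost_mpo_program m n chi (B : {set 'I_n}) :
    (0 < m)%N -> (0 < chi)%N ->
  (cost (mpo_program m chi B) <= 48 * (n * m * chi ^ (m + 1)))%N.
Proof.
move=> m_gt0 chi_gt0; apply: leq_trans (@cost_network _ _ _ _ _ _ _ m _) _.
  by move=> _; rewrite size_enum_ord.
rewrite !card_ord prednK // addn1; move: (chi ^ _)%N => q.
have -> : (48 * (n * m * q) = 24 * (n * (2 * m) * q))%N by lia.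
by rewrite leq_mul2l leq_mul2r leq_mul2l (_ : m.+1 <= 2 * m)%N ?orbT //; lia.
Qed.

Lemma run_mpo_program (K : numClosedFieldType) m n chi (B : {set 'I_n})
    (W : mpo K n chi) :
    (0 < chi)%N ->
  run (entry_val W) (mpo_program m chi B) = pt_moment m B (mpo_op W).
Proof.
move=> chi_gt0; rewrite run_network => [|i|i k]; rewrite ?enum_uniq ?mem_enum //.
rewrite -(trchain_vchain_exchange m (fun i s s' (a b : 'I_chi.-1.+1) =>
  source_val (entry_val W)
    (entry_source chi i (if i \in B then (s', s) else (s, s')) a b)) ord0).
rewrite /pt_moment -[m in _ ^+ m](size_enum_ord m) mxtrace_exp_trchain.
apply: eq_trchain => _ s t; rewrite !elt_op_of train_prod_vchain //.
by apply: eq_vchain => // i a b; rewrite !ffunE; case: ifP.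
Qed.

(** * Matrix product states *)

Lemma glue_notin (I : finType) (C : {set I}) s c (i : I) (iC : i \notin C) :
  @glue I C s c i = s (exist _ i iC).
Proof.
by rewrite ffunE (insubT (fun i => i \notin C) iC).
Qed.

Lemma glue_in (I : finType) (C : {set I}) s c (i : I) (iC : i \in C) :
  @glue I C s c i = c (exist _ i iC).
Proof. by rewrite ffunE (@insubF _ (fun i => i \notin C)) ?iC //= (insubT (fun i => i \in C) iC). Qed.

Lemma restrict_glue_in (I : finType) (C : {set I}) s c :
  Defs.restrict (fun i => i \in C) (@glue I C s c) = c.
Proof. by apply/ffunP => -[i iC]; rewrite ffunE glue_in. Qed.

Lemma restrict_glue_notin (I : finType) (C : {set I}) s c :
  Defs.restrict (fun i => i \notin C) (@glue I C s c) = s.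
Proof. by apply/ffunP => -[i iC]; rewrite ffunE glue_notin. Qed.

Lemma glue_restrict (I : finType) (C : {set I}) (s : conf I) :
  @glue I C (Defs.restrict _ s) (Defs.restrict _ s) = s.
Proof.
apply/ffunP => i; case: (boolP (i \in C)) => iC; first by rewrite glue_in ffunE.
by rewrite glue_notin ffunE.
Qed.

Lemma elt_proj (K : numClosedFieldType) (I : finType) (f : conf I -> K) s t :
  elt (proj (ket_of f)) s t = f s * (f t)^*.
Proof. by rewrite /elt mxE big_ord1 !mxE !enum_rankK. Qed.

Lemma eq_train_prod (K : numClosedFieldType) (P : Type) n chi
    (T : train K P n chi) (x y : 'I_n -> P) :
  x =1 y -> train_prod T x = train_prod T y.
Proof.
move=> eqxy; have eqk k le_kn : @train_prefix K P n chi T x k le_kn =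
    train_prefix T y le_kn.
  by elim: k => //= k IHk in le_kn *; rewrite IHk eqxy.
by rewrite /train_prod eqk.
Qed.

Section MPS.
Variables (n chi : nat) (B C : {set 'I_n}).

(* The ring of a site runs through the tensors A (slot (k, false)) and conj A
   (slot (k, true)) of each copy k, the tensor carrying the incoming label
   first: A off B, conj A on B.  On C both carry a private label u, and the
   label along the ring is forced to be false. *)
Definition mps_order m (i : 'I_n) : seq ('I_m * bool) :=
  flatten [seq [:: (k, i \in B); (k, i \notin B)] | k <- enum 'I_m].

(** Off [C] the condition [s' == s] makes the label between the two tensors a copy of the incoming
    one, and the second tensor carries the outgoing label. On [C] the label between them is the
    private one. *)
Definition mps_coef m (i : 'I_n) (x : 'I_m * bool) (s s' : bool)
    (a b : 'I_chi.-1.+1) : coef (entry_name bool n chi) :=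
  let: (ok, label) :=
    if x.2 == (i \in B) then (if i \in C then ~~ s else s' == s, s')
    else if i \in C then (~~ s', s) else (true, s') in
  (x.2, if ok then entry_source chi i label a b else inr false).

Definition mps_program m : program (entry_name bool n chi) :=
  network_program ord0 (@mps_coef m) (@mps_order m).

Lemma size_mps_order m i : size (@mps_order m i) = (2 * m)%N.
Proof.
rewrite size_flatten /shape -map_comp sumnE big_map big_enum /=.
by rewrite sum_nat_const card_ord mulnC.
Qed.

Lemma mem_mps_order m i x : x \in @mps_order m i.
Proof.
case: x => k b; apply/flattenP; exists [:: (k, i \in B); (k, i \notin B)].
  by apply: map_f; rewrite mem_enum.
by rewrite !inE !xpair_eqE eqxx; case: b (i \in B) => [] [].
Qed.

Lemma uniq_mps_order m i : uniq (@mps_order m i).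
Proof.
apply/card_uniqP; rewrite size_mps_order (eq_card (B := predT)).
  by rewrite card_prod card_ord card_bool mulnC.
by move=> x; rewrite mem_mps_order.
Qed.

(** There are [2 * m] slots, and the constant is 3 times 24, from [(2 * m).+1 <= 3 * m]. *)
Lemma cost_mps_program m :
  (0 < m)%N -> (0 < chi)%N ->
  (cost (mps_program m) <= 72 * (n * m * chi ^ (2 * m + 1)))%N.
Proof.
move=> m_gt0 chi_gt0.
apply: leq_trans (@cost_network _ _ _ _ _ _ _ (2 * m) (@size_mps_order m)) _.
rewrite card_prod !card_ord card_bool prednK // addn1 mulnC (mulnC m).
move: (chi ^ _)%N => q; rewrite mulnC.
have -> : (72 * (n * m * q) = 24 * (n * (3 * m) * q))%N by lia.
rewrite leq_mul2l leq_mul2r leq_mul2l.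
by rewrite (_ : (2 * m).+1 <= 3 * m)%N ?orbT //; lia.
Qed.

(** [u] is the label between the two tensors of a copy; on [C] it becomes the summation variable of
    the partial trace. *)
Definition mps_ok (i : 'I_n) (u s s' : bool) : bool :=
  if i \in C then ~~ s && ~~ s' else u == s.

Definition mps_ket_label (i : 'I_n) (u s s' : bool) : bool :=
  if i \in C then u else if i \in B then s' else s.

Definition mps_bra_label (i : 'I_n) (u s s' : bool) : bool :=
  if i \in C then u else if i \in B then s else s'.

Variables (K : numClosedFieldType) (T : mps K n chi).

Let E := 'I_chi.-1.+1.
Let ent (i : 'I_n) (p : bool) (a b : E) : K :=
  source_val (entry_val T) (entry_source chi i p a b).

Definition mps_kernel (i : 'I_n) (s s' : bool) (d d' : E * E) : K :=
  \sum_u (mps_ok i u s s')%:R * (ent i (mps_ket_label i u s s') d.1 d'.1 *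
    (ent i (mps_bra_label i u s s') d.2 d'.2)^*).

Lemma trchain_mps_coef m i (a c : {ffun 'I_m * bool -> E}) :
  trchain (fun x s s' =>
      coef_val (entry_val T) (mps_coef i x s s' (a x) (c x))) (@mps_order m i) =
  trchain (fun k s s' => mps_kernel i s s'
      (a (k, false), a (k, true)) (c (k, false), c (k, true))) (enum 'I_m).
Proof.
apply: eq_bigr => s _; rewrite vchain_flatten2; apply: eq_vchain => // k s1 s2.
apply: eq_bigr => u _; rewrite /mps_coef /mps_ok /mps_ket_label /mps_bra_label.
rewrite /coef_val /= eqxx /ent.
have zero : source_val (entry_val T) (inr false) = 0 by [].
case: (i \in B); case: (i \in C) => /=; case: u; case: s1; case: s2 => /=;
  by rewrite ?zero ?rmorph0 ?mul0r ?mulr0 ?mul1r // mulrC.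
Qed.

(** The local sums over [u] are pulled out as one sum over [z]; then the constraints factor out and
    the ket and bra chains separate. *)
Lemma vchain_mps_kernel (s t : {ffun 'I_n -> bool}) :
    (0 < chi)%N ->
  vchain (fun i => mps_kernel i (s i) (t i)) (enum 'I_n)
    (dirac K (ord0, ord0)) (ord0, ord0) =
  \sum_(z : {ffun 'I_n -> bool} | [forall i, mps_ok i (z i) (s i) (t i)])
    train_prod T (fun i => mps_ket_label i (z i) (s i) (t i)) *
    (train_prod T (fun i => mps_bra_label i (z i) (s i) (t i)))^*.
Proof.
move=> chi_gt0; rewrite -(sum_vchain (fun i u (d d' : E * E) =>
  (mps_ok i u (s i) (t i))%:R * (ent i (mps_ket_label i u (s i) (t i)) d.1 d'.1 *
    (ent i (mps_bra_label i u (s i) (t i)) d.2 d'.2)^*))).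
rewrite [RHS]big_mkcond; apply: eq_bigr => z _; rewrite vchain_scale.
case: ifPn => [/forallP ok|/forallPn[i /negbTE nok]]; last first.
  by rewrite big_enum (bigD1 i) //= nok !mul0r.
rewrite big1 => [|i _]; last by rewrite ok.
rewrite mul1r !train_prod_vchain //.
rewrite -(rmorph_vchain (Num.conj : {rmorphism K -> K})) -vchain_pair.
apply: eq_vchain => // -[d1 d2]; rewrite /dirac xpair_eqE.
by rewrite /= rmorph_nat -natrM mulnb.
Qed.

Lemma run_mps_program m :
    (0 < m)%N -> (0 < chi)%N ->
  run (entry_val T) (mps_program m) =
  pt_moment m [set j : {i | i \notin C} | val j \in B]
    (ptrace C (proj (mps_ket T))).
Proof.
move=> m_gt0 chi_gt0.
rewrite run_network; [|exact: uniq_mps_order|exact: mem_mps_order].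
(* The two bonds of each copy, for the ket and for the bra, are grouped into one pair. *)
pose phi (a : {ffun 'I_m * bool -> E}) : {ffun 'I_m -> E * E} :=
  [ffun k => (a (k, false), a (k, true))].
pose psi (a : {ffun 'I_m -> E * E}) : {ffun 'I_m * bool -> E} :=
  [ffun x => if x.2 then (a x.1).2 else (a x.1).1].
have phiK : cancel phi psi.
  by move=> a; apply/ffunP => -[k []]; rewrite !ffunE.
have psiK : cancel psi phi.
  by move=> a; apply/ffunP => k; rewrite !ffunE /= -surjective_pairing.
have phi0 : phi [ffun=> ord0] = [ffun=> (ord0, ord0)].
  by apply/ffunP => k; rewrite !ffunE.
transitivity (vchain (fun i (a c : {ffun 'I_m -> E * E}) =>
    trchain (fun k s s' => mps_kernel i s s' (a k) (c k)) (enum 'I_m))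
  (enum 'I_n) (dirac K [ffun=> (ord0, ord0)]) [ffun=> (ord0, ord0)]).
  rewrite -phi0 -vchain_bij; last by exists psi.
  apply: eq_vchain => [i a c|a /=]; last by rewrite /dirac (can_eq phiK).
  by rewrite trchain_mps_coef; apply: eq_trchain => k s s'; rewrite !ffunE.
rewrite -(trchain_vchain_exchange m mps_kernel).
rewrite /pt_moment -[m in _ ^+ m](size_enum_ord m) mxtrace_exp_trchain.
(* The rings run over labels of all sites, whereas the reduced state has none on [C]; [emb] fills in
   the value [false] forced there. *)
pose emb (s : conf {i | i \notin C}) : conf 'I_n := glue s [ffun=> false].
have nemb (s : {ffun 'I_n -> bool}) :
    s \notin codom emb -> exists2 i, i \in C & s i.
  move=> s_emb; apply/exists_inP; apply: contraNT s_emb.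
  rewrite negb_exists_in => /forall_inP s0; apply/codomP.
  exists (Defs.restrict _ s); rewrite -[LHS](glue_restrict C); congr glue.
  by apply/ffunP => -[i iC]; rewrite !ffunE; apply/negbTE/s0.
rewrite (trchain_inj (phi := emb)) ?size_enum_ord //; first last.
- move=> _ s t /nemb[i iC ti]; rewrite vchain_mps_kernel // big_pred0 // => z.
  by apply/negbTE/forallPn; exists i; rewrite /mps_ok iC ti andbF.
- move=> _ s t /nemb[i iC si]; rewrite vchain_mps_kernel // big_pred0 // => z.
  by apply/negbTE/forallPn; exists i; rewrite /mps_ok iC si.
- apply: (can_inj (g := Defs.restrict (fun i => i \notin C))) => s.
  exact: restrict_glue_notin.
apply: eq_trchain => _ s t; rewrite vchain_mps_kernel // !elt_op_of.
(* The constraint fixes [z] to [s] off [C] and leaves it free on [C], so [z] is [glue s c] with [c]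
   the traced configuration. *)
rewrite (reindex_onto (glue s) (Defs.restrict (fun i => i \in C))) => [|z /forallP ok].
  apply: eq_big => [c|c _].
    rewrite restrict_glue_in eqxx andbT; apply/forallP => i; rewrite /mps_ok.
    case: ifPn => iC; first by rewrite !glue_in !ffunE.
    by rewrite !glue_notin.
  rewrite elt_proj; congr (_ * _^*).
    apply: eq_train_prod => i; rewrite /mps_ket_label.
    case: ifPn => iC; first by rewrite !glue_in.
    by rewrite /emb !glue_notin !ffunE inE.
  apply: eq_train_prod => i; rewrite /mps_bra_label.
  case: ifPn => iC; first by rewrite !glue_in.
  by rewrite /emb !glue_notin !ffunE inE.
rewrite -[RHS](glue_restrict C); congr glue; apply/ffunP => -[i iC].
have := ok i; rewrite /mps_ok ifN // => /eqP; rewrite /emb !glue_notin ffunE /=.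
by move->.
Qed.

End MPS.

Theorem mainTheorem15 :
  (exists (c : nat)
     (prog : forall (alpha n chi : nat) (A B C : {set 'I_n}),
        program (entry_name bool n chi)),
   forall (alpha n chi : nat) (A B C : {set 'I_n}),
     (1 <= alpha)%N -> (1 <= n)%N -> (1 <= chi)%N ->
     A :|: B :|: C = [set: 'I_n] ->
     [disjoint A & B] -> [disjoint A & C] -> [disjoint B & C] ->
     (cost (prog alpha n chi A B C)
        <= c * (n * alpha * chi ^ (2 * alpha + 1)))%N /\
     (forall (R : realType) (T : mps R[i] n chi),
        normalized (mps_ket T) ->
        run (entry_val T) (prog alpha n chi A B C) =
        pt_moment alpha [set j : {i | i \notin C} | val j \in B]
          (ptrace C (proj (mps_ket T)))))
  /\
  (exists (c : nat)
     (prog : forall (alpha n chi : nat) (A B : {set 'I_n}),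
        program (entry_name (bool * bool)%type n chi)),
   forall (alpha n chi : nat) (A B : {set 'I_n}),
     (1 <= alpha)%N -> (1 <= n)%N -> (1 <= chi)%N ->
     A :|: B = [set: 'I_n] -> [disjoint A & B] ->
     (cost (prog alpha n chi A B)
        <= c * (n * alpha * chi ^ (alpha + 1)))%N /\
     (forall (R : realType) (T : mpo R[i] n chi),
        density_matrix (mpo_op T) ->
        run (entry_val T) (prog alpha n chi A B) =
        pt_moment alpha B (mpo_op T))).
Proof.
split.
  exists 72, (fun alpha n chi A B C => mps_program chi B C alpha).
  move=> alpha n chi A B C alpha_gt0 _ chi_gt0 _ _ _ _.
  by split=> [|R T _]; [apply: cost_mps_program | apply: run_mps_program].
exists 48, (fun alpha n chi A B => mpo_program alpha chi B).
move=> alpha n chi A B alpha_gt0 _ chi_gt0 _ _.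
by split=> [|R T _]; [apply: cost_mpo_program | apply: run_mpo_program].
Qed.
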